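(* Let $(P_t)_{t\ge 0}$ be an irreducible Markov semi-group on a finite state space $\mathcal{X}$, with unique invariant law $\pi$. Then for every initial law $\mu\in\mathcal{P}(\mathcal{X})$ and every time $t\ge 0$, $$H(\mu P_t\,|\,\pi)\le \overline{\mathrm{d}}(t)\,H(\mu\,|\,\pi),\qquad\text{where}\qquad \overline{\mathrm{d}}(t):=\max_{x,y\in\mathcal{X}}\mathrm{d}_{\mathrm{TV}}\left(P_t(x,\cdot),P_t(y,\cdot)\right).$$
   Context: A Markov semi-group on a finite set $\mathcal{X}$ is $P_t=e^{tL}$, $t\ge0$, where $L$ is the generator (rate matrix) of a continuous-time Markov chain on $\mathcal{X}$; it is irreducible if the chain is. Reversibility is not assumed. $\mathcal{P}(\mathcal{X})$ is the set of probability measures on $\mathcal{X}$, $\mathrm{d}_{\mathrm{TV}}(\mu,\nu)=\frac12\sum_x|\mu(x)-\nu(x)|$ is the total-variation distance, and $H(\mu\,|\,\pi):=\sum_x\mu(x)\log(\mu(x)/\pi(x))$ is the relative entropy (with $0\log0=0$). *)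

(* Defs.v *)
From mathcomp Require Import all_boot all_order all_algebra.
From mathcomp Require Import all_classical all_reals all_analysis.
Set Implicit Arguments.
Unset Strict Implicit.
Unset Printing Implicit Defensive.
Import Order.TTheory GRing.Theory Num.Theory.
Import numFieldNormedType.Exports.
Local Open Scope classical_set_scope.
Local Open Scope ring_scope.

(* The limit is taken in the max-norm topology of the space of matrices. *)
Definition mxexp (R : realType) (n : nat) (A : 'M[R]_n) : 'M[R]_n :=
  limn (series (fun k : nat => (k`!%:R)^-1 *: A ^+ k)).

Section MarkovSemigroup.
Variables (R : realType) (X : finType).
Implicit Types (L : X -> X -> R) (mu nu pi : X -> R).

Definition is_generator L : Prop :=
  (forall x y, x != y -> 0 <= L x y) /\ (forall x, \sum_y L x y = 0).

(* MathComp matrices are indexed by ordinals, so kernels on X are transported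
   along the canonical enumeration of X. *)
Definition kernel_mx L : 'M[R]_#|X| :=
  \matrix_(i, j) L (enum_val i) (enum_val j).

(* The transition kernel P_t = e^{tL}, with P_t(x, y) = semigroup L t x y. *)
Definition semigroup L (t : R) (x y : X) : R :=
  mxexp (t *: kernel_mx L) (enum_rank x) (enum_rank y).

(* Every state is reachable from every other one: P_t(x, y) is the probability
   that the chain started at x is at y at time t. *)
Definition irreducible L : Prop :=
  forall x y, exists2 t : R, 0 <= t & 0 < semigroup L t x y.

Definition is_law mu : Prop := (forall x, 0 <= mu x) /\ \sum_x mu x = 1.

Definition law_at L mu (t : R) (y : X) : R := \sum_x mu x * semigroup L t x y.

Definition invariant_law L pi : Prop :=
  is_law pi /\ (forall t : R, 0 <= t -> forall y, law_at L pi t y = pi y).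

Definition tv_dist mu nu : R := 2^-1 * \sum_x `|mu x - nu x|.

(* The default value 0 of the iterated maximum is harmless: tv_dist is
   nonnegative. *)
Definition dbar L (t : R) : R :=
  \big[Num.max/0]_(p : X * X)
    tv_dist (semigroup L t p.1) (semigroup L t p.2).

(* The convention 0 log 0 = 0 holds automatically, as 0 * _ = 0.  The value is
   only meaningful when pi x > 0 for every x with mu x > 0 (division by zero
   yields 0 here, not +oo); invariant laws of irreducible chains charge every
   point. *)
Definition rel_entropy mu pi : R := \sum_x mu x * ln (mu x / pi x).

End MarkovSemigroup.

(* Main.v *)
(* On a finite set of points, x ln x coincides with an affine function plus a
   nonnegative combination of the functions |x - g|.  Hence H(m | pi) is a
   nonnegative combination of the quantities |v|_1 - |sum v| for v = m - g pi,
   whose weights and thresholds can be chosen to serve both m = mu and m = mu P.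
   Splitting v into positive and negative parts shows that a stochastic matrix
   contracts |v|_1 - |sum v| by its Dobrushin coefficient.  To see that e^{tL}
   is stochastic, shift the generator by a multiple of the identity: with
   Q = tL + c entrywise nonnegative, e^{tL} = e^{-c} e^Q. *)

Require Import Defs.
From mathcomp Require Import all_boot all_order all_algebra.
From mathcomp Require Import all_classical all_reals all_analysis.
From mathcomp Require Import ring lra.
Set Implicit Arguments.
Unset Strict Implicit.
Unset Printing Implicit Defensive.
Import Order.TTheory GRing.Theory Num.Theory.
Import numFieldNormedType.Exports.
Local Open Scope classical_set_scope.
Local Open Scope ring_scope.

(** * Cauchy products of scalar series *)

Definition cauchy_prod (R : realType) (a b : nat -> R) (n : nat) : R :=
  \sum_(i < n.+1) a (n - i)%N * b i.

(** The product of partial sums runs over the square [i, j < N], the partial sum of the Cauchy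
    product over the triangle [i + j < N]; the opposite corner remains. *)
Lemma cauchy_prod_defect (R : realType) (a b : nat -> R) (N : nat) :
  series a N * series b N - series (cauchy_prod a b) N =
  \sum_(i < N) \sum_(j < N | (N <= i + j)%N) a j * b i.
Proof.
have -> : series (cauchy_prod a b) N =
    \sum_(i < N) \sum_(j < N | ~~ (N <= i + j)%N) a j * b i.
  transitivity
    (\sum_(0 <= n < N) \sum_(0 <= i < N | (i <= n)%N) a (n - i)%N * b i).
    apply: eq_big_nat => n /andP[_ nN].
    rewrite /cauchy_prod -(big_mkord xpredT (fun i => a (n - i)%N * b i)).
    by rewrite (big_nat_widen _ _ N)//=; apply: eq_bigl => i; rewrite ltnS.
  rewrite (exchange_big_dep_nat xpredT)//= big_mkord; apply: eq_bigr => i _.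
  rewrite -(big_mkord (fun j => ~~ (N <= i + j)%N) (fun j => a j * b i)).
  transitivity (\sum_(0 + i <= n < N) a (n - i)%N * b i).
    by rewrite add0n [RHS](big_nat_widenl _ 0).
  rewrite big_addn (big_nat_widen _ _ N) ?leq_subr//=.
  apply: eq_big => j; first by rewrite -ltnNge ltn_subRL.
  by rewrite addnK.
rewrite /series/= !big_mkord [X in X - _]mulrC mulr_suml -sumrB.
apply: eq_bigr => i _.
by rewrite mulrC mulr_suml (bigID (fun j : 'I_N => (N <= i + j)%N))/= addrK.
Qed.

Lemma exp_coeffD (R : realType) (x y : R) :
  cauchy_prod (exp_coeff x) (exp_coeff y) = exp_coeff (x + y).
Proof.
apply/funext => n; rewrite /cauchy_prod /exp_coeff /= exprDn mulr_suml.
apply: eq_bigr => i _; have := ltn_ord i; rewrite ltnS => le_in.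
rewrite -(bin_fact le_in) !natrM -[_ *+ _]mulr_natr; field.
by rewrite !pnatr_eq0 -!lt0n !fact_gt0/= bin_gt0.
Qed.

Lemma cvg_series_exp_coeff (R : realType) (x : R) :
  series (exp_coeff x) @ \oo --> expR x.
Proof. exact: is_cvg_series_exp_coeff. Qed.

(* The defect between the product of the partial sums and the partial sum of the
   product is dominated by that of the exponential series, which tends to
   e^x e^y - e^(x + y) = 0. *)
Lemma cvg_cauchy_prod (R : realType) (a b : nat -> R) (x y p q : R) :
    (forall k, `|a k| <= exp_coeff x k) ->
    (forall k, `|b k| <= exp_coeff y k) ->
    series a @ \oo --> p -> series b @ \oo --> q ->
  series (cauchy_prod a b) @ \oo --> p * q.
Proof.
move=> ax bY ap bq.
pose D (u v : nat -> R) N :=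
  series u N * series v N - series (cauchy_prod u v) N.
have D0 : D (exp_coeff x) (exp_coeff y) @ \oo --> 0.
  rewrite -(subrr (expR (x + y))) {1}expRD /D exp_coeffD.
  apply: cvgB; last exact: cvg_series_exp_coeff.
  by apply: cvgM; exact: cvg_series_exp_coeff.
have Dab : D a b @ \oo --> 0.
  apply/norm_cvg0P; apply: squeeze_cvgr (cvg_cst 0) D0.
  near=> N; rewrite normr_ge0/= /D !cauchy_prod_defect.
  apply: le_trans (ler_norm_sum _ _ _) _; apply: ler_sum => i _.
  apply: le_trans (ler_norm_sum _ _ _) _; apply: ler_sum => j _.
  by rewrite normrM ler_pM.
have -> : series (cauchy_prod a b) =
    (fun N => series a N * series b N - D a b N).
  by apply/funext => N; rewrite /D subKr.
by rewrite -[p * q]subr0; apply: cvgB => //; exact: cvgM.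
Unshelve. all: by end_near. Qed.

(** * Exponential of a generator matrix *)

(** Reduces the matrix limit to scalar ones: balls of matrices are entrywise, and there are finitely
    many entries. *)
Lemma mxexp_eq (R : realType) (n : nat) (A l : 'M[R]_n) :
    (forall i j, series (fun k => (A ^+ k) i j / k`!%:R) @ \oo --> l i j) ->
  mxexp A = l.
Proof.
move=> Al; apply: (cvg_lim (@norm_hausdorff _ _)).
apply/cvg_ballP => e e0.
have : \forall N \near \oo, forall ij : 'I_n * 'I_n,
    ball (l ij.1 ij.2) e (series (fun k => (A ^+ k) ij.1 ij.2 / k`!%:R) N).
  by apply: filter_forall => ij; move/cvg_ballP: (Al ij.1 ij.2); apply.
apply: filterS => N H; split => // i j; have := H (i, j) => /=.
congr (ball _ _ _); rewrite /series /= summxE; apply: eq_bigr => k _.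
by rewrite mxE mulrC.
Qed.

Lemma row_sum_mxX (R : realType) (n : nat) (A : 'M[R]_n) (c : R) (k : nat) :
    (forall i, \sum_j A i j = c) ->
  forall i, \sum_j (A ^+ k) i j = c ^+ k.
Proof.
move=> Ac; elim: k => [|k IH] i.
  rewrite expr0 (bigD1 i)//= big1 => [|j ji]; rewrite !mxE ?eqxx ?addr0//.
  by rewrite eq_sym (negbTE ji).
rewrite exprS; under eq_bigr do rewrite mxE.
rewrite exchange_big /= exprS -{1}(Ac i) mulr_suml.
by apply: eq_bigr => m _; rewrite -mulr_sumr IH.
Qed.

Lemma mxX_ge0 (R : realType) (n : nat) (A : 'M[R]_n) (k : nat) :
  (forall i j, 0 <= A i j) -> forall i j, 0 <= (A ^+ k) i j.
Proof.
move=> A0; elim: k => [|k IH] i j.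
  by rewrite expr0 mxE; case: eqP.
by rewrite exprS mxE; apply: sumr_ge0 => m _; rewrite mulr_ge0.
Qed.

Lemma scalar_mxX (R : comPzRingType) (n : nat) (c : R) (k : nat) :
  (c%:M : 'M[R]_n) ^+ k = (c ^+ k)%:M.
Proof. by elim: k => // k IH; rewrite !exprS IH scalar_mxM. Qed.

(** Signs are read off e^{-c} e^Q; row sums come from the series of [A] itself, whose positive
    powers have zero row sums. *)
Lemma mxexp_stochastic (R : realType) (n : nat) (A : 'M[R]_n) :
    (forall i j, i != j -> 0 <= A i j) -> (forall i, \sum_j A i j = 0) ->
  (forall i j, 0 <= mxexp A i j) /\ (forall i, \sum_j mxexp A i j = 1).
Proof.
move=> A0 As.
(* [c] is at least every [- A i i], so [Q] is nonnegative, with all row sums equal to [c]. *)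
pose c := \sum_i `|A i i|; pose Q := A + c%:M.
have Q0 i j : 0 <= Q i j.
  rewrite !mxE; have [->|ij] := eqVneq i j; last by rewrite mulr0n addr0 A0.
  rewrite mulr1n /c (bigD1 j)//= addrA addr_ge0 ?sumr_ge0//.
  by have := ler_norm (- A j j); rewrite normrN; lra.
have Qc i : \sum_j Q i j = c.
  under eq_bigr do rewrite !mxE.
  rewrite big_split /= As add0r (bigD1 i)//= eqxx mulr1n big1 ?addr0// => j ji.
  by rewrite eq_sym (negbTE ji) mulr0n.
pose a i j k := (Q ^+ k) i j / k`!%:R.
have a_ge0 i j k : 0 <= a i j k.
  by rewrite divr_ge0//; exact: mxX_ge0.
(* An entry of [Q ^+ k] is at most its row sum [c ^+ k]. *)
have a_le i j k : a i j k <= exp_coeff c k.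
  rewrite ler_pM2r ?invr_gt0 ?ltr0n ?fact_gt0//.
  rewrite -(row_sum_mxX k Qc i) (bigD1 j)//= lerDl.
  by apply: sumr_ge0 => m _; exact: mxX_ge0.
have a_cvg i j : series (a i j) @ \oo --> limn (series (a i j)).
  apply: series_le_cvg (a_ge0 i j) _ (a_le i j) _.
    by move=> k; exact: le_trans (a_ge0 i j k) _.
  exact: is_cvg_series_exp_coeff.
have b_le k : `|exp_coeff (- c) k| <= exp_coeff `|c| k.
  by rewrite /exp_coeff /= normrM normrX normrN normfV normr_nat.
pose l := \matrix_(i, j) (limn (series (a i j)) * expR (- c)).
have A_cvg i j : series (fun k => (A ^+ k) i j / k`!%:R) @ \oo --> l i j.
  (* Scalar matrices commute with [Q], so the binomial formula for [A = Q - c] yields a Cauchy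
     product. *)
  have -> : (fun k => (A ^+ k) i j / k`!%:R) =
      cauchy_prod (a i j) (exp_coeff (- c)).
    apply/funext => k; have -> : A = Q + (- c)%:M by rewrite raddfN addrK.
    rewrite exprDn_comm; last exact: comm_mx_scalar.
    rewrite summxE mulr_suml; apply: eq_bigr => m _.
    rewrite scalar_mxX -mulmxE mul_mx_scalar mulmxnE !mxE /a /exp_coeff /=.
    have := ltn_ord m; rewrite ltnS => mk.
    rewrite -(bin_fact mk) !natrM -[_ *+ _]mulr_natr; field.
    by rewrite !pnatr_eq0 -!lt0n !fact_gt0/= bin_gt0.
  rewrite mxE; have na_le k : `|a i j k| <= exp_coeff c k by rewrite ger0_norm.
  exact: cvg_cauchy_prod na_le b_le (a_cvg i j) (@cvg_series_exp_coeff _ (- c)).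
rewrite (mxexp_eq A_cvg); split => i.
  move=> j; rewrite mxE mulr_ge0 ?expR_ge0//.
  apply: cvgr_to_ge (a_cvg i j) _; near=> N.
  by rewrite /series/= sumr_ge0.
have : (fun N => \sum_j series (fun k => (A ^+ k) i j / k`!%:R) N) @ \oo -->
    \sum_j l i j.
  by apply: cvg_big => [|j _]; [exact: add_continuous|exact: A_cvg].
move=> /(cvg_lim (@norm_hausdorff _ R)) <-.
(* Only [k = 0] contributes; the partial sum is empty at [N = 0], hence the threshold 1. *)
apply: (lim_near_cst (@norm_hausdorff _ R)); exists 1 => // N /= N1.
rewrite /series/= exchange_big /= big_ltn//= -mulr_suml fact0 divr1.
rewrite (row_sum_mxX 0 As) expr0 big_nat big1 ?addr0// => k /andP[k0 _].
by rewrite -mulr_suml (row_sum_mxX k As) expr0n gtn_eqF// mul0r.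
Unshelve. all: by end_near. Qed.

(** * Piecewise-linear interpolation and convexity of x ln x *)

Definition pl_sum (R : realType) (ws : seq (R * R)) (x : R) : R :=
  \sum_(k <- ws) k.1 * `|x - k.2|.

Lemma convex_interpolation (R : realType) (f : R -> R) (x y : R) (s : seq R) :
    (forall u v w, 0 <= u -> u < v -> v < w ->
       (w - u) * f v <= (w - v) * f u + (v - u) * f w) ->
    0 <= x -> path <%R x (y :: s) ->
  exists a b (ws : seq (R * R)), all (fun k => 0 <= k.1) ws /\
    {in x :: y :: s, forall z, f z = a + b * z + pl_sum ws z}.
Proof.
move=> fC x0 xys.
(* The interpolant is affine to the right of the last node and, by convexity,
   stays below f there, so the next kink is added with a weight >= 0. *)
suff [a [b [ws [ws0 fE _ _]]]] : exists a b (ws : seq (R * R)),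
    [/\ all (fun k => 0 <= k.1) ws,
        {in x :: y :: s, forall z, f z = a + b * z + pl_sum ws z},
        {in x :: y :: s, forall z, z <= last y s} &
        exists c d, forall z, last y s <= z ->
          a + b * z + pl_sum ws z = c + d * z /\ c + d * z <= f z].
  by exists a, b, ws.
elim/last_ind: s xys => [|s t IH].
  move=> /= /andP[xy _]; have yx0 : y - x != 0 by rewrite subr_eq0 gt_eqF.
  pose b := (f y - f x) / (y - x).
  have bE : b * (y - x) = f y - f x by rewrite divfK.
  exists (f x - b * x), b, [::]; split => //.
  - move=> z; rewrite !inE /pl_sum big_nil => /orP[] /eqP ->; first by ring.
    by rewrite addr0 addrAC -addrA -mulrBr bE; ring.
  - by move=> z; rewrite !inE => /orP[] /eqP ->; rewrite ?lexx ?ltW.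
  exists (f x - b * x), b => z yz; rewrite /pl_sum big_nil addr0; split => //.
  move: yz; rewrite le_eqVlt => /predU1P[<-|yz].
    have -> : f x - b * x + b * y = f x + b * (y - x) by ring.
    by rewrite bE; lra.
  (* By convexity the chord through [x] and [y], prolonged beyond [y], lies below [f]. *)
  have := fC _ _ _ x0 xy yz.
  have fyE : f y = f x + b * (y - x) by rewrite bE; ring.
  rewrite fyE => h.
  rewrite -(ler_pM2l (_ : 0 < y - x)) ?subr_gt0//.
  by move: h; set p := f x; set q := f z; nra.
rewrite -rcons_cons rcons_path last_cons => /andP[/IH {IH}].
move=> [a [b [ws [ws0 fE l_max [c [d g_aff]]]]]] lt_.
set l := last y s in l_max g_aff lt_.
(* Adding W (z - l) + W |z - l| = 2 W max(z - l, 0) changes nothing at the nodes up to [l]; this [W]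
   makes the value at [t] correct. *)
pose W := (f t - (c + d * t)) / (2 * (t - l)).
have tl : 0 < t - l by rewrite subr_gt0.
have WE : 2 * W * (t - l) = f t - (c + d * t).
  by rewrite /W; field; rewrite gt_eqF.
have W0 : 0 <= W.
  rewrite divr_ge0 ?subr_ge0 ?mulr_ge0// ?(ltW tl)//.
  by have [] := g_aff t (ltW lt_).
have l_in : l \in x :: y :: s by rewrite inE mem_last orbT.
have l0 : 0 <= l by rewrite (le_trans x0)// l_max// mem_head.
have fl : f l = c + d * l.
  by rewrite (fE _ l_in); have [] := g_aff _ (lexx l).
exists (a - W * l), (b + W), ((W, l) :: ws); split.
- by rewrite /= W0.
- move=> z; rewrite -!rcons_cons mem_rcons inE => /predU1P[->|zin].
    rewrite /pl_sum big_cons /= ger0_norm ?(ltW tl)//.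
    have [] := g_aff t (ltW lt_); rewrite /pl_sum => gt _.
    by apply/eqP; rewrite -subr_eq0; apply/eqP; move: gt WE; lra.
  rewrite /pl_sum big_cons /= ler0_norm ?subr_le0 ?l_max// (fE _ zin) /pl_sum.
  by ring.
- move=> z; rewrite last_rcons -!rcons_cons mem_rcons inE => /predU1P[->//|zin].
  by rewrite (le_trans (l_max _ zin))// ltW.
(* The new last piece is the line through the graph points at [l] and [t]; convexity puts it below
   [f] beyond [t]. *)
- exists (c - 2 * W * l), (d + 2 * W) => z; rewrite last_rcons => tz.
  have lz : l <= z by exact: le_trans (ltW lt_) tz.
  have [gz fz] := g_aff z lz; split.
    rewrite /pl_sum big_cons /= ger0_norm ?subr_ge0//; move: gz.
    by rewrite /pl_sum; lra.
  move: tz; rewrite le_eqVlt => /predU1P[<-|tz]; first by move: WE; lra.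
  have := fC _ _ _ l0 lt_ tz.
  have -> : f t = c + d * t + 2 * W * (t - l) by rewrite WE; ring.
  rewrite fl => h; rewrite -(ler_pM2l tl).
  by move: h; set q := f z; nra.
Qed.

(** For x > 0 this is ln s <= s - 1 at s = y / x, multiplied by x; at x = 0 the left side equals
    -y. *)
Lemma xlnx_tangent (R : realType) (x y : R) : 0 <= x -> 0 < y ->
  y * ln y + (ln y + 1) * (x - y) <= x * ln x.
Proof.
move=> x0 y0; move: x0; rewrite le_eqVlt => /predU1P[<-|x0].
  by rewrite mul0r; lra.
have yx0 : 0 < y / x by rewrite divr_gt0.
have : ln (1 + (y / x - 1)) <= y / x - 1 by apply: le_ln1Dx; lra.
rewrite addrC subrK ln_div// => h.
have : x * (ln y - ln x) <= x * (y / x - 1) by rewrite ler_pM2l.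
have -> : x * (y / x - 1) = y - x by field; rewrite gt_eqF.
by lra.
Qed.

(** Weight the tangent bounds from [v] at [u] and [w] by [w - v] and [v - u]: the slope terms
    cancel. *)
Lemma xlnx_convex (R : realType) (u v w : R) : 0 <= u -> u < v -> v < w ->
  (w - u) * (v * ln v) <= (w - v) * (u * ln u) + (v - u) * (w * ln w).
Proof.
move=> u0 uv vw.
have v0 : 0 < v by exact: le_lt_trans uv.
have w0 : 0 <= w by rewrite ltW// (lt_trans v0).
have := xlnx_tangent u0 v0; have := xlnx_tangent w0 v0.
rewrite -(ler_pM2l (_ : 0 < v - u)) ?subr_gt0// => hw.
rewrite -(ler_pM2l (_ : 0 < w - v)) ?subr_gt0// => hu.
by move: hu hw; lra.
Qed.

(** * Contraction of the defect and of the entropy *)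

Lemma l1_defect_contraction (R : realType) (X : finType) (P : X -> X -> R)
    (d : R) (v : X -> R) :
    (forall x y, 0 <= P x y) -> (forall x, \sum_y P x y = 1) ->
    (forall x z, tv_dist (P x) (P z) <= d) ->
  \sum_y `|\sum_x v x * P x y| - `|\sum_x v x| <=
  d * (\sum_x `|v x| - `|\sum_x v x|).
Proof.
move=> P0 P1 Pd.
wlog v_le0 : v / \sum_x v x <= 0.
  move=> H; have [|/ltW v_ge0] := lerP (\sum_x v x) 0; first exact: H.
  have := H (fun x => - v x); rewrite sumrN oppr_le0 normrN => /(_ v_ge0).
  under eq_bigr do under eq_bigr do rewrite mulNr.
  under eq_bigr do rewrite sumrN normrN.
  by under [in X in _ <= X]eq_bigr do rewrite normrN.
(* Positive and negative parts, of masses A <= B; the initial defect is then 2 A. *)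
pose a x := (`|v x| + v x) / 2; pose b x := (`|v x| - v x) / 2.
have a0 x : 0 <= a x.
  by rewrite /a; have := ler_norm (- v x); rewrite normrN; lra.
have b0 x : 0 <= b x by rewrite /b; have := ler_norm (v x); lra.
have vE x : v x = a x - b x by rewrite /a /b; lra.
have nvE x : `|v x| = a x + b x by rewrite /a /b; lra.
pose A := \sum_x a x; pose B := \sum_x b x.
have svE : \sum_x v x = A - B.
  by rewrite -sumrB; apply: eq_bigr.
have snvE : \sum_x `|v x| = A + B.
  by rewrite -big_split; apply: eq_bigr.
have A0 : 0 <= A by exact: sumr_ge0.
have AB : A <= B by move: v_le0; rewrite svE; lra.
(* The main argument multiplies by [B]; if [B = 0], then [v] vanishes. *)
have [B0|B0] := eqVneq B 0.
  have Ae0 : A = 0 by apply/eqP; rewrite eq_le A0 -B0 AB.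
  have v0 x : v x = 0.
    have a0x : a x = 0 by exact: (psumr_eq0P (fun x _ => a0 x) Ae0).
    have b0x : b x = 0 by exact: (psumr_eq0P (fun x _ => b0 x) B0).
    by rewrite vE a0x b0x subrr.
  under eq_bigr do under eq_bigr do rewrite v0 mul0r.
  rewrite big1 => [|y _]; last by rewrite big1 ?normr0.
  by rewrite svE snvE Ae0 B0 subrr addr0 normr0 subrr mulr0.
rewrite (ler0_norm v_le0) svE snvE.
have -> : A + B - - (A - B) = 2 * A by ring.
rewrite opprB -(ler_pM2l (_ : 0 < B)); last by rewrite lt_def B0 (le_trans A0).
rewrite mulrBr mulr_sumr.
(* All of [a] is matched with a share A / B of [b] by the product coupling; the unmatched mass
   [B - A] of [b] is merely transported. *)
have key y : B * (\sum_x v x * P x y) =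
    \sum_x \sum_z a x * b z * (P x y - P z y) - (B - A) * \sum_z b z * P z y.
  rewrite [in RHS]mulrBl.
  have -> : B * (\sum_z b z * P z y) = \sum_x \sum_z b x * b z * P z y.
    rewrite mulr_suml; apply: eq_bigr => x _; rewrite mulr_sumr.
    by apply: eq_bigr => z _; rewrite mulrA.
  have -> : A * (\sum_z b z * P z y) = \sum_x \sum_z a x * b z * P z y.
    rewrite mulr_suml; apply: eq_bigr => x _; rewrite mulr_sumr.
    by apply: eq_bigr => z _; rewrite mulrA.
  rewrite opprB addrA -big_split/= [X in _ - X]exchange_big -sumrB mulr_sumr.
  apply: eq_bigr => x _; rewrite -big_split -sumrB mulr_suml /=.
  by apply: eq_bigr => z _; rewrite vE; ring.
have bd y : B * `|\sum_x v x * P x y| <=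
    \sum_x \sum_z a x * b z * `|P x y - P z y| + (B - A) * \sum_z b z * P z y.
  rewrite -[B in B * _]ger0_norm ?(le_trans A0)// -normrM key.
  apply: le_trans (ler_normB _ _) _; apply: lerD.
    apply: le_trans (ler_norm_sum _ _ _) _; apply: ler_sum => x _.
    apply: le_trans (ler_norm_sum _ _ _) _; apply: ler_sum => z _.
    by rewrite normrM ger0_norm// mulr_ge0.
  rewrite ger0_norm// mulr_ge0 ?subr_ge0//.
  by apply: sumr_ge0 => z _; rewrite mulr_ge0.
apply: le_trans (lerB (ler_sum _ (fun y _ => bd y)) (lexx _)) _.
have d0 x z : \sum_y `|P x y - P z y| <= 2 * d.
  by have := Pd x z; rewrite /tv_dist; lra.
rewrite big_split /= -mulr_sumr.
have -> : \sum_y \sum_z b z * P z y = B.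
  rewrite exchange_big /=; apply: eq_bigr => z _.
  by rewrite -mulr_sumr P1 mulr1.
have : \sum_y \sum_x \sum_z a x * b z * `|P x y - P z y| <= A * (B * (2 * d)).
  rewrite exchange_big /= mulr_suml; apply: ler_sum => x _.
  rewrite exchange_big /= mulr_suml mulr_sumr; apply: ler_sum => z _.
  by rewrite -mulr_sumr -mulrA !ler_wpM2l.
by nra.
Qed.

Lemma entropy_contraction (R : realType) (X : finType) (P : X -> X -> R)
    (pi mu : X -> R) (d : R) :
    (forall x y, 0 <= P x y) -> (forall x, \sum_y P x y = 1) ->
    (forall x z, tv_dist (P x) (P z) <= d) ->
    is_law pi -> (forall x, 0 < pi x) ->
    (forall y, \sum_x pi x * P x y = pi y) -> is_law mu ->
  rel_entropy (fun y => \sum_x mu x * P x y) pi <= d * rel_entropy mu pi.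
Proof.
move=> P0 P1 Pd [_ spi] pi0 piP [mu0 smu].
set mu' := fun y => _.
have mu'0 y : 0 <= mu' y by apply: sumr_ge0 => x _; rewrite mulr_ge0.
have smu' : \sum_y mu' y = 1.
  rewrite exchange_big /= -smu; apply: eq_bigr => x _.
  by rewrite -mulr_sumr P1 mulr1.
pose ratios m := [seq m x / pi x | x <- enum X].
(* Ratios of both laws are included so that one interpolant serves both; 0 and 1 guarantee two
   nodes, and 1 also fixes the affine part. *)
pose nodes := sort <=%R (undup (0 :: 1 :: ratios mu ++ ratios mu')).
have nodesE : nodes =i 0 :: 1 :: ratios mu ++ ratios mu'.
  by move=> z; rewrite mem_sort mem_undup.
have nodes_sorted : sorted <%R nodes.
  by rewrite sort_lt_sorted undup_uniq.
have nodes_ge0 : {in nodes, forall z, 0 <= z}.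
  move=> z; rewrite nodesE !inE mem_cat => /or3P[/eqP->//|/eqP->//|/orP[]].
    by move=> /mapP[x _ ->]; rewrite divr_ge0// ltW.
  by move=> /mapP[x _ ->]; rewrite divr_ge0// ltW.
have [a [b [ws [ws0 fE]]]] : exists a b (ws : seq (R * R)),
    all (fun k => 0 <= k.1) ws /\
    {in nodes, forall z, z * ln z = a + b * z + pl_sum ws z}.
  case: nodes nodes_ge0 nodesE nodes_sorted => [|x [|y s]] n0 nE ns.
  - by have := nE 0; rewrite !inE eqxx.
  - have := nE 0; have := nE 1; rewrite !inE !eqxx orbT.
    by move=> /eqP <- /eqP /esym/eqP; rewrite oner_eq0.
  - apply: convex_interpolation => //; [exact: xlnx_convex|].
    by rewrite n0 ?mem_head.
have ent m : (\sum_x m x = 1) -> {subset ratios m <= nodes} ->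
    rel_entropy m pi = \sum_(k <- ws)
      k.1 * (\sum_x `|m x - k.2 * pi x| - `|\sum_x (m x - k.2 * pi x)|).
  move=> sm subm.
  (* As 1 ln 1 = 0, the affine part, which integrates to [a + b], supplies exactly the subtracted
     terms |1 - g|. *)
  have f1 : a + b + \sum_(k <- ws) k.1 * `|1 - k.2| = 0.
    have := fE 1; rewrite ln1 mulr0 mulr1 nodesE !inE eqxx orbT.
    by move=> /(_ isT)/esym.
  under [RHS]eq_bigr => k _ do rewrite sumrB -mulr_sumr sm spi mulr1 mulrBr.
  have relE : rel_entropy m pi =
      \sum_x (a * pi x + b * m x + \sum_(k <- ws) k.1 * `|m x - k.2 * pi x|).
    apply: eq_bigr => x _.
    have pix : pi x != 0 by rewrite gt_eqF.
    transitivity (pi x * (m x / pi x * ln (m x / pi x))).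
      by rewrite mulrA mulrCA divff// mulr1.
    rewrite fE; last by apply/subm/mapP; exists x; rewrite ?mem_enum.
    rewrite !mulrDr mulr_sumr; congr (_ + _ + _); first by rewrite mulrC.
      by field.
    apply: eq_bigr => k _; rewrite mulrCA; congr (_ * _).
    rewrite -{1}(gtr0_norm (pi0 x)) -normrM; congr `|_|; by field.
  rewrite sumrB relE big_split big_split /= -!mulr_sumr sm spi exchange_big /=.
  under eq_bigr do rewrite -mulr_sumr.
  by move: f1; lra.
rewrite !ent//; first last.
- by move=> z zin; rewrite nodesE !inE mem_cat zin !orbT.
- by move=> z zin; rewrite nodesE !inE mem_cat zin !orbT.
rewrite mulr_sumr !big_seq; apply: ler_sum => k kin.
rewrite mulrCA ler_wpM2l//; first by move/allP: ws0; apply.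
have := l1_defect_contraction (fun x => mu x - k.2 * pi x) P0 P1 Pd.
(* Invariance of [pi] makes the image of [mu - g pi] the same combination for [mu']. *)
have mu'E y : \sum_x (mu x - k.2 * pi x) * P x y = mu' y - k.2 * pi y.
  under eq_bigr do rewrite mulrBl -mulrA.
  by rewrite sumrB -mulr_sumr piP.
under eq_bigr do rewrite mu'E.
rewrite [in X in _ -> X]sumrB -mulr_sumr smu' spi.
by rewrite !sumrB -!mulr_sumr smu spi.
Qed.

(** * Application to the semi-group *)

Lemma semigroup_stochastic (R : realType) (X : finType) (L : X -> X -> R)
    (t : R) :
    is_generator L -> 0 <= t ->
  (forall x y, 0 <= semigroup L t x y) /\
  (forall x, \sum_y semigroup L t x y = 1).
Proof.
move=> [L0 Ls] t0.
have [||P0 P1] := @mxexp_stochastic R #|X| (t *: kernel_mx L).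
- move=> i j ij; rewrite !mxE mulr_ge0// L0//.
  by apply: contra_neq ij => /enum_val_inj.
- move=> i; under eq_bigr do rewrite !mxE.
  rewrite -mulr_sumr; have /esym := Ls (enum_val i).
  rewrite (reindex (fun j : 'I_#|X| => enum_val j)) => [<-|].
    by rewrite mulr0.
  exact/onW_bij/enum_val_bij.
split=> x; first by move=> y; exact: P0.
by rewrite -(P1 (enum_rank x)) [RHS](reindex enum_rank)//;
  exact/onW_bij/enum_rank_bij.
Qed.

(** Some [x] has positive mass, and pi(y) >= pi(x) P_t(x, y) > 0 for a [t] at which [y] is reached
    from [x]. *)
Lemma invariant_law_gt0 (R : realType) (X : finType) (L : X -> X -> R)
    (pi : X -> R) :
  is_generator L -> irreducible L -> invariant_law L pi -> forall y, 0 < pi y.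
Proof.
move=> Lg Lirr [[pi0 pi1] piP] y.
have [x pix] : exists x, 0 < pi x.
  apply/existsP; apply: contra_eqT pi1 => /existsPn pi_le0.
  rewrite big1 ?(eq_sym 0) ?oner_eq0// => x _.
  by apply/le_anti; rewrite pi0 leNgt pi_le0.
have [t t0 Pxy] := Lirr x y.
have [P0 _] := semigroup_stochastic Lg t0.
rewrite -(piP t t0 y) /law_at (bigD1 x)//= ltr_pwDl ?mulr_gt0//.
by apply: sumr_ge0 => z _; rewrite mulr_ge0.
Qed.

Theorem corollary1 (R : realType) (X : finType) (L : X -> X -> R)
    (L_gen : is_generator L) (L_irr : irreducible L)
    (pi : X -> R) (pi_inv : invariant_law L pi)
    (mu : X -> R) (mu_law : is_law mu) (t : R) (t_ge0 : 0 <= t) :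
  rel_entropy (law_at L mu t) pi <= dbar L t * rel_entropy mu pi.
Proof.
have [P0 P1] := semigroup_stochastic L_gen t_ge0.
have pi0 := invariant_law_gt0 L_gen L_irr pi_inv.
case: pi_inv => pi_law piP; apply: entropy_contraction => //; last exact: piP.
move=> x z; rewrite /dbar.
exact: (le_bigmax 0
  (fun p => tv_dist (semigroup L t p.1) (semigroup L t p.2)) (x, z)).
Qed.
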